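(* Consider the one-period Combined Market with $n$ lives described in the context, with excess $e\in[0,n]$ and XoL price $X_0^e$, and assume that it is arbitrage-free. Let the loan amount satisfy $S_0d<L\le S_0u$ and $L-S_0d=1$. Then there is a minimal superhedging portfolio for the NNEG claim $D_1(L-S_1)^+$, consisting of assets in the Combined Market, with price process $\{V_t\}_{t=0,1}$, and a $\mathbb{Q}\in\mathcal{M}^e$ satisfying $$V_0=\mathbb{E}^{\mathbb{Q}}[D_1(L-S_1)^+].$$ Case 1. If $\frac{X_0^e}{n-e}<q$ and $np\ge eq+X_0^e$, then the minimal superhedging portfolio is constructed from a holding of $e$ property puts and one XoL contract with excess $e$, at a cost of $V_0=eq+X_0^e$. Case 2. If $np<eq+X_0^e$, then the minimal superhedging portfolio is constructed from a holding of one GLA contract, at a cost of $V_0=np$. Case 3. If $\frac{X_0^e}{n-e}\ge q$, then the minimal superhedging portfolio is constructed from a holding of $n$ property puts, at a cost of $V_0=nq$.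
   Context: Sample space: $\Omega=\{0,1\}^{n+1}$ with the power set $\mathcal{F}$; write $\omega=(\omega_0,\omega_1,\dots,\omega_n)$. $D_1(\omega)=\omega_1+\dots+\omega_n$ is the number of deaths. Combined Market (times $t=0,1$; all prices discounted; any long or short positions are allowed, no frictions). Assets: - cash, with constant price $1$; - a property stock with $S_0>0$, $S_1=S_0u$ if $\omega_0=1$ and $S_1=S_0d$ if $\omega_0=0$, where $0<d<1<u$; - for $i=1,\dots,n$ a single-life assurance with price $p\in(0,1)$ at time $0$ and payout $L_1^{(i)}(\omega)=\omega_i$ at time $1$; - a group life assurance (GLA) with price $np$ at time $0$ and payout $D_1$ at time $1$ (redundant: it is a holding of one of each single-life assurance); - an excess-of-loss (XoL) contract with excess $e$, price $X_0^e$ at time $0$ and payout $X_1^e=(D_1-e)^+$ at time $1$. $L>0$ is the loan amount. A property put is the payout $(L-S_1)^+$, which can be synthesised from cash and stock. Put $q:=\frac{u-1}{u-d}$; this is the cost of the property put when $S_0d<L\le S_0u$ and $L-S_0d=1$. A portfolio is a vector of real holdings in these assets; $V_0$ is its price at time $0$ and $V_1$ its (random) value at time $1$. It is a superhedging portfolio for a claim $C$ if $V_1\ge C$; it is minimal if its initial cost $V_0$ is smallest among all superhedging portfolios of the claim. The market is arbitrage-free if there is no portfolio with $V_0\le 0$, $V_1\ge0$ and $V_1$ not identically zero. $\mathbb{P}$ is a reference probability measure on $(\Omega,\mathcal{F})$ under which $L_1^{(1)},\dots,L_1^{(n)}$ are independent Bernoulli random variables with success (death) probability $p$. $\mathcal{M}$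 is the set of probability measures $\mathbb{Q}$ on $(\Omega,\mathcal{F})$, absolutely continuous with respect to $\mathbb{P}$, under which all discounted asset price processes are martingales, i.e. $\mathbb{Q}(S_1=S_0d)=q$; $\mathbb{Q}(L_1^{(i)}=1)=p$ for $i=1,\dots,n$; and $X_0^e=\sum_{e<k\le n}(k-e)\mathbb{Q}(D_1=k)$. $\mathcal{M}^e\subset\mathcal{M}$ is the set of all $\mathbb{Q}\in\mathcal{M}$ under which the sequence of random variables $\omega_1,\dots,\omega_n$ is exchangeable ($\omega_0$ is not included in the exchangeable sequence). The superscript in $\mathcal{M}^e$ stands for ''exchangeable'' and is unrelated to the excess $e$.
   Formalization: The excess e is taken to be an integer (for non-integer e the claim fails, e.g. n=2, e=1/2, p=q=1/2, X_0^e=0.6), and the reference measure P is assumed to charge every state of Ω (otherwise no measure in M^e need exist). *)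

(* Defs.v *)
From HB Require Import structures.
From mathcomp Require Import all_boot all_order all_algebra perm.
From mathcomp Require Import all_classical all_reals all_analysis.

Set Implicit Arguments.
Unset Strict Implicit.
Unset Printing Implicit Defensive.

From mathcomp Require Import ring lra.
Import Order.TTheory GRing.Theory Num.Theory.
Local Open Scope classical_set_scope.
Local Open Scope ring_scope.

(* Coordinate [ord0] is the property outcome; the lives are the coordinates
   [lift ord0 i] for [i : 'I_n]. *)
Definition state (n : nat) := {ffun 'I_n.+1 -> bool}.

HB.instance Definition _ n := Finite.on (state n).
HB.instance Definition _ n := isPointed.Build (state n) [ffun=> false].
HB.instance Definition _ n := @isMeasurable.Build default_measure_display
  (state n) discrete_measurable discrete_measurable0
  discrete_measurableC discrete_measurableU.

Definition up {n} (w : state n) : bool := w ord0.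
Definition dies {n} (i : 'I_n) (w : state n) : bool := w (lift ord0 i).
Definition deaths {n} (w : state n) : nat := (\sum_(i < n) dies i w)%N.

Record market (R : realType) := Market {
  S0 : R;
  u : R;
  d : R;
  p : R;
  excess : nat;  (* a number of deaths; the result fails for real excesses *)
  X0 : R;  (* price of the XoL contract *)
}.

Inductive asset (n : nat) := Cash | Stock | Life of 'I_n | GLA | XoL.
Arguments Cash {n}. Arguments Stock {n}. Arguments GLA {n}. Arguments XoL {n}.

Section Market.
Context {R : realType} {n : nat}.
Implicit Types (mkt : market R) (w : state n).

Definition price mkt (a : asset n) : R :=
  match a with
  | Cash => 1
  | Stock => S0 mkt
  | Life _ => p mkt
  | GLA => n%:R * p mkt
  | XoL => X0 mkt
  end.

Definition S1 mkt w : R := S0 mkt * (if up w then u mkt else d mkt).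

Definition payout mkt (a : asset n) w : R :=
  match a with
  | Cash => 1
  | Stock => S1 mkt w
  | Life i => (dies i w)%:R
  | GLA => (deaths w)%:R
  | XoL => Num.max ((deaths w)%:R - (excess mkt)%:R) 0
  end.

Definition portfolio := asset n -> R.

Definition value (f : asset n -> R) (phi : portfolio) : R :=
  phi Cash * f Cash + phi Stock * f Stock
  + \sum_(i < n) phi (Life i) * f (Life i)
  + phi GLA * f GLA + phi XoL * f XoL.

Definition V0 mkt (phi : portfolio) : R := value (price mkt) phi.
Definition V1 mkt (phi : portfolio) w : R := value (payout mkt ^~ w) phi.

Definition arbitrage_free mkt : Prop :=
  ~ exists phi : portfolio,
      [/\ V0 mkt phi <= 0, forall w, 0 <= V1 mkt phi w
        & exists w, V1 mkt phi w != 0].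

Definition superhedges mkt (phi : portfolio) (C : state n -> R) : Prop :=
  forall w, C w <= V1 mkt phi w.

Definition minimal_superhedge mkt (phi : portfolio) (C : state n -> R) : Prop :=
  superhedges mkt phi C /\
  forall psi, superhedges mkt psi C -> V0 mkt phi <= V0 mkt psi.

Definition put_payout mkt (L : R) w : R := Num.max (L - S1 mkt w) 0.

Definition nneg mkt (L : R) w : R := (deaths w)%:R * put_payout mkt L w.

Definition q mkt : R := (u mkt - 1) / (u mkt - d mkt).

(* The cash and stock holding replicating the two values of the put; see
   [put_replicates] and [put_cost]. *)
Definition property_put mkt (L : R) : portfolio := fun a =>
  let pu := Num.max (L - S0 mkt * u mkt) 0 in
  let pd := Num.max (L - S0 mkt * d mkt) 0 in
  match a with
  | Cash => (u mkt * pd - d mkt * pu) / (u mkt - d mkt)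
  | Stock => (pu - pd) / (S0 mkt * (u mkt - d mkt))
  | _ => 0
  end.

Definition one_gla : portfolio := fun a => if a is GLA then 1 else 0.
Definition one_xol : portfolio := fun a => if a is XoL then 1 else 0.

(* Mutual independence of a finite family of real random variables. *)
Definition independent (P : probability (state n) R)
    (X : 'I_n -> state n -> R) : Prop :=
  forall (J : {set 'I_n}) (B : 'I_n -> set R),
    (forall i, measurable (B i)) ->
    P [set w | forall i, i \in J -> B i (X i w)] =
    (\prod_(i in J) P (X i @^-1` B i))%E.

(* Full support matches superhedging and arbitrage being stated pointwise:
   without it there may be no martingale measure dominated by [P] (take
   [P [set w | ~~ up w] = 0]). *)
Definition reference_measure mkt (P : probability (state n) R) : Prop :=
  [/\ forall w, (0 < P [set w])%E,
      forall i : 'I_n, P [set w | payout mkt (Life i) w = 1] = (p mkt)%:E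
    & independent P (fun i => payout mkt (Life i))].

(* There is one period and the initial sigma-algebra is trivial, so an asset is
   a martingale when its expected payout is its price; [martingale_measureP]
   gives the explicit equations. *)
Definition martingale_measure mkt (P Q : probability (state n) R) : Prop :=
  Q `<< P /\ forall a, ('E_Q[payout mkt a] = (price mkt a)%:E)%E.

Definition exchangeable (Q : probability (state n) R) : Prop :=
  forall (s : {perm 'I_n}) (x : 'I_n -> bool),
    Q [set w | forall i, dies (s i) w = x i] =
    Q [set w | forall i, dies i w = x i].

Definition exchangeable_martingale_measure mkt
    (P Q : probability (state n) R) : Prop :=
  martingale_measure mkt P Q /\ exchangeable Q.


Lemma put_replicates mkt (L : R) w :
  0 < S0 mkt -> d mkt < u mkt ->
  V1 mkt (property_put mkt L) w = put_payout mkt L w.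
Proof.
move=> S_gt0 du; rewrite /V1 /value /put_payout /S1 /=.
rewrite big1 => [|i _]; last by rewrite mul0r.
have S_neq0 : S0 mkt != 0 by rewrite gt_eqF.
have ud_neq0 : u mkt - d mkt != 0 by rewrite subr_eq0 gt_eqF.
by rewrite /S1; case: (up w); field; rewrite ud_neq0 S_neq0.
Qed.

Lemma put_cost mkt (L : R) :
  0 < S0 mkt -> d mkt < u mkt ->
  S0 mkt * d mkt < L -> L <= S0 mkt * u mkt -> L - S0 mkt * d mkt = 1 ->
  V0 mkt (property_put mkt L) = q mkt.
Proof.
move=> S_gt0 du dL Lu L1; rewrite /V0 /value /q /=.
rewrite big1 => [|i _]; last by rewrite mul0r.
rewrite L1 (max_idPl ler01) (max_idPr _) ?subr_le0//.
have S_neq0 : S0 mkt != 0 by rewrite gt_eqF.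
have ud_neq0 : u mkt - d mkt != 0 by rewrite subr_eq0 gt_eqF.
by field; rewrite ud_neq0 S_neq0.
Qed.

Lemma expectation_state (Q : probability (state n) R) (X : state n -> R) :
  ('E_Q[X] = \sum_w (X w)%:E * Q [set w])%E.
Proof.
have XE : X = (fun w => \sum_(v : state n) X v * \1_[set v] w).
  apply/funext => w; rewrite (bigD1 w)//= big1 ?addr0.
    by rewrite indicE mem_set// mulr1.
  move=> v vw; rewrite indicE memNset ?mulr0//= => wv.
  by rewrite wv eqxx in vw.
have finQ (A : set (state n)) : Q A \is a fin_num by exact: fin_num_measure.
have int1 (v : state n) :
    (\int[Q]_w (X v * \1_[set v] w)%:E = (X v)%:E * Q [set v])%E.
  under eq_integral do rewrite EFinM.
  rewrite integralZl//=; last exact: integrable_indic.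
  by rewrite integral_indic// setIT.
rewrite unlock [in LHS]XE.
under eq_integral do rewrite -sumEFin.
rewrite integral_sum//=; first by apply: eq_bigr => v _; exact: int1.
move=> v; under eq_fun do rewrite EFinM.
by apply: integrableZl => //; exact: integrable_indic.
Qed.

Lemma expectation_fine (Q : probability (state n) R) (X : state n -> R) :
  'E_Q[X]%E = (\sum_w X w * fine (Q [set w]))%:E.
Proof.
rewrite expectation_state -sumEFin; apply: eq_bigr => w _.
by rewrite EFinM fineK// fin_num_measure.
Qed.

Lemma probability_fine (Q : probability (state n) R) (A : set (state n)) :
  Q A = (\sum_w \1_A w * fine (Q [set w]))%:E.
Proof. by rewrite -expectation_fine expectation_indic. Qed.

Lemma deaths_le w : (deaths w <= n)%N.
Proof.
rewrite -[leqRHS]card_ord -sum1_card.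
by apply: leq_sum => i _; case: (dies i w).
Qed.

Lemma martingale_measureP mkt (P Q : probability (state n) R) :
  0 < S0 mkt -> d mkt < u mkt ->
  martingale_measure mkt P Q <->
  [/\ Q `<< P,
      Q [set w | S1 mkt w = S0 mkt * d mkt] = (q mkt)%:E,
      forall i : 'I_n, Q [set w | payout mkt (Life i) w = 1] = (p mkt)%:E
    & (X0 mkt)%:E = (\sum_((excess mkt).+1 <= k < n.+1)
        (k%:R - (excess mkt)%:R)%:E * Q [set w | deaths w = k])%E].
Proof.
move=> S_gt0 du.
have ud_neq0 : u mkt - d mkt != 0 by rewrite subr_eq0 gt_eqF.
have S_neq0 : S0 mkt != 0 by rewrite gt_eqF.
pose m w := fine (Q [set w]).
have m1 : \sum_w m w = 1.
  have := probability_setT Q; rewrite probability_fine => -[<-].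
  by apply: eq_bigr => w _; rewrite indicT mul1r.
have Ecash : ('E_Q[payout mkt Cash] = (price mkt Cash)%:E)%E.
  by rewrite expectation_fine /= -mulr_sumr -/m m1 mulr1.
have Estock : ('E_Q[payout mkt Stock] = (price mkt Stock)%:E)%E <->
    Q [set w | S1 mkt w = S0 mkt * d mkt] = (q mkt)%:E.
  rewrite expectation_fine probability_fine /=.
  set D := [set w | _].
  have -> : \sum_w S1 mkt w * m w = S0 mkt * u mkt
      - S0 mkt * (u mkt - d mkt) * \sum_w \1_D w * m w.
    rewrite -[X in X - _]mulr1 -m1 !mulr_sumr -sumrB; apply: eq_bigr => w _.
    rewrite indicE mulrA -mulrBl; congr (_ * _).
    case: (boolP (up w)) => uw.
      rewrite memNset ?mulr0 ?subr0 /S1 ?uw// /D /= /S1 uw => /(mulfI S_neq0).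
      by move=> ud; rewrite ud ltxx in du.
    by rewrite mem_set /D /= /S1 (negbTE uw)//; ring.
  split=> -[h]; congr _%:E.
    apply: (mulfI S_neq0); apply: (mulfI ud_neq0).
    rewrite mulrA [_ * S0 mkt]mulrC -[LHS](subKr (S0 mkt * u mkt)) h /q.
    by field.
  by rewrite h /q; field.
have Elife i : 'E_Q[payout mkt (Life i)]%E =
    Q [set w | payout mkt (Life i) w = 1].
  rewrite -expectation_indic//; congr 'E_Q[_]%E; apply/funext => w.
  rewrite indicE /=; case: (boolP (dies i w)) => iw.
    by rewrite mem_set//= iw.
  by rewrite memNset//= (negbTE iw) => /eqP; rewrite eq_sym oner_eq0.
have Egla : (forall i, ('E_Q[payout mkt (Life i)] = (p mkt)%:E)%E) ->
    ('E_Q[payout mkt GLA] = (price mkt GLA)%:E)%E.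
  move=> El; rewrite expectation_fine /=; congr _%:E.
  under eq_bigr do rewrite natr_sum mulr_suml.
  rewrite exchange_big /= (eq_bigr (fun=> p mkt)) => [|i _].
    by rewrite sumr_const card_ord mulr_natl.
  by have := El i; rewrite expectation_fine => -[].
have Exol : 'E_Q[payout mkt XoL]%E = (\sum_((excess mkt).+1 <= k < n.+1)
    (k%:R - (excess mkt)%:R)%:E * Q [set w | deaths w = k])%E.
  rewrite expectation_fine /=.
  under [RHS]eq_bigr do rewrite probability_fine -EFinM mulr_sumr.
  rewrite sumEFin exchange_big /=; congr _%:E; apply: eq_bigr => w _.
  under eq_bigr do rewrite mulrA.
  rewrite -mulr_suml; congr (_ * _).
  case: (leqP (deaths w) (excess mkt)) => we.
    rewrite (max_idPr _) ?subr_le0 ?ler_nat// big_nat big1// => k /andP[ek _].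
    rewrite indicE memNset ?mulr0//= => wk.
    by rewrite wk leqNgt ek in we.
  rewrite (max_idPl _) ?subr_ge0 ?ler_nat 1?ltnW//.
  rewrite (bigD1_seq (deaths w)) ?iota_uniq ?mem_index_iota ?we ?ltnS ?deaths_le//=.
  rewrite indicE mem_set//= mulr1 big1 ?addr0// => k kw.
  by rewrite indicE memNset ?mulr0//= => wk; rewrite wk eqxx in kw.
split=> [[QP E]|[QP Es El Ex]].
  split=> //; first exact/Estock.
  - by move=> i; rewrite -Elife E.
  - by rewrite -Exol E.
split=> // -[||i||] //; first exact/Estock.
- by rewrite Elife El.
- by apply: Egla => i; rewrite Elife El.
- by rewrite Exol -Ex.
Qed.

End Market.

(* Main.v *)
Require Import Defs.
From mathcomp Require Import all_boot all_order all_algebra perm fingroup.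
From mathcomp Require Import all_classical all_reals all_analysis.
From mathcomp Require Import ring lra.

Import Order.TTheory GRing.Theory Num.Theory.
Local Open Scope ring_scope.

(* Under a martingale measure Q the expectation of the claim is a lower bound
   for the cost of every superhedge, so a superhedge whose cost is attained as
   such an expectation is minimal. The three portfolios all superhedge, at costs
   eq + X0, np and nq. Absence of arbitrage places (np, X0) in the convex hull of
   the points (k, (k - e)^+), hence in the triangle spanned by k = 0, e, n, so
   there is a law of the number of deaths on {0, e, n} with the right prices.
   Letting the property fall in the worst mortality states first, and making the
   lives exchangeable, gives a Q under which the claim has expectation
   min (np, eq + X0, nq). *)

(** * Finite mixtures of point masses *)

Lemma finite_mixture (R : realType) (disp : measure_display)
    (T : measurableType disp) (I : finType) (c : I -> R) (x : I -> T) :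
  (forall i, 0 <= c i) -> \sum_i c i = 1 ->
  exists Q : probability T R,
    forall A, Q A = (\sum_i (c i)%:E * \d_(x i) A)%E.
Proof.
move=> c_ge0 c1.
have [i0 _] : {i0 : I | true}.
  apply: sigW; have [i0 _|I0] := pickP (fun _ : I => true); first by exists i0.
  by move: c1; rewrite big_pred0 // => /eqP; rewrite eq_sym oner_eq0.
pose m i : {measure set T -> \bar R} := mscale (NngNum (c_ge0 i)) \d_(x i).
(* [msum] is indexed by naturals, so [I] is enumerated; [mzero] fills the indices from [#|I|] on,
   which never enter the sum. *)
pose mu : {measure set T -> \bar R} :=
  msum (fun k => if insub k is Some j then m (enum_val (j : 'I_#|I|))
                 else mzero) #|I|.
have muE A : mu A = (\sum_i (c i)%:E * \d_(x i) A)%E.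
  transitivity (\sum_(j < #|I|) m (enum_val j) A)%E.
    by apply: eq_bigr => j _; rewrite valK.
  by rewrite [RHS](reindex (enum_val (A := I))) //; apply/onW_bij/enum_val_bij.
have muT : mu setT = 1%E.
  rewrite muE -[1%E]/(1%:E) -c1 -sumEFin; apply: eq_bigr => i _.
  by rewrite diracT mule1.
(* The total mass is 1, so normalising changes nothing; [\d_(x i0)] is only the fallback of
   [mnormalize]. *)
exists (mnormalize mu \d_(x i0)) => A; rewrite -muE.
rewrite -[LHS]/(mnormalize mu \d_(x i0) A) /mnormalize muT onee_eq0 /=.
by rewrite invr1 mule1.
Qed.

(** * Relabelling the lives and symmetric laws *)

Section States.
Context {R : realType} {n : nat}.
Implicit Types (w : state n) (s : {perm 'I_n}).

Definition permute s w : state n :=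
  [ffun k => if unlift ord0 k is Some i then dies (s i) w else up w].

Lemma up_permute s w : up (permute s w) = up w.
Proof. by rewrite /up ffunE unlift_none. Qed.

Lemma dies_permute s i w : dies i (permute s w) = dies (s i) w.
Proof. by rewrite /dies ffunE liftK. Qed.

Lemma deaths_permute s w : deaths (permute s w) = deaths w.
Proof.
rewrite /deaths [RHS](reindex_inj (@perm_inj _ s)).
by apply: eq_bigr => i _; rewrite dies_permute.
Qed.

(** [(s * t)%g] applies [s] first, so pulling back along permutations is a left action; the
    symmetrisation rests on this. *)
Lemma permuteM s t w : permute s (permute t w) = permute (s * t)%g w.
Proof.
apply/ffunP => k; rewrite !ffunE up_permute.
by case: unliftP => // i _; rewrite dies_permute permM.
Qed.

(** A representative of each property outcome and death count; averaging over permutations spreads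
    it over all states with the same data. *)
Definition first_die (b : bool) (k : nat) : state n :=
  [ffun j => if unlift ord0 j is Some i then (i < k)%N else b].

Lemma up_first_die b k : up (first_die b k) = b.
Proof. by rewrite /up ffunE unlift_none. Qed.

Lemma deaths_first_die b k : (k <= n)%N -> deaths (first_die b k) = k.
Proof.
move=> kn; rewrite /deaths; under eq_bigr do rewrite /dies ffunE liftK.
rewrite -(big_mkord xpredT (fun i => nat_of_bool (i < k)%N)).
rewrite (big_cat_nat (n := k)) //= [X in (_ + X)%N]big_nat.
rewrite [X in (_ + X)%N]big1 => [|i /andP[ki _]]; last by rewrite ltnNge ki.
rewrite big_nat (eq_bigr (fun=> 1%N)) => [|i /andP[_ ->]] //.
by rewrite -big_nat sum_nat_const_nat subn0 muln1 addn0.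
Qed.

(* Averaging the point masses at [first_die (b j) (k j)] over all permutations
   of the lives. *)
Lemma symmetric_mixture (J : finType) (c : J -> R) (b : J -> bool)
    (k : J -> nat) :
  (forall j, 0 <= c j) -> \sum_j c j = 1 -> (forall j, (k j <= n)%N) ->
  exists Q : probability (state n) R,
    (forall s f, ('E_Q[f \o permute s] = 'E_Q[f])%E) /\
    (forall F : bool -> nat -> R,
      ('E_Q[fun w => F (up w) (deaths w)] = (\sum_j c j * F (b j) (k j))%:E)%E).
Proof.
move=> c_ge0 c1 kn; pose N : R := #|{perm 'I_n}|%:R.
have N_gt0 : 0 < N.
  by rewrite ltr0n; apply/card_gt0P; exists 1%g.
pose cI (i : {perm 'I_n} * J) := N^-1 * c i.2.
pose xI (i : {perm 'I_n} * J) := permute i.1 (first_die (b i.2) (k i.2)).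
have avg (f : {perm 'I_n} * J -> R) : \sum_i cI i * f i =
    N^-1 * \sum_s \sum_j c j * f (s, j).
  rewrite pair_bigA mulr_sumr; apply: eq_bigr => -[s j] _ /=.
  by rewrite mulrA.
have avg_cst (a : J -> R) : N^-1 * \sum_(s : {perm 'I_n}) \sum_j a j = \sum_j a j.
  by rewrite sumr_const -[X in _ * X]mulr_natl mulKf // gt_eqF.
have [||Q QE] := finite_mixture R _ (state n) _ cI xI.
- by move=> i; apply: mulr_ge0; rewrite ?invr_ge0 ?c_ge0 // ltW.
- rewrite (eq_bigr (fun i => cI i * 1)) => [|i _]; last by rewrite mulr1.
  rewrite avg; under eq_bigr do under eq_bigr do rewrite mulr1.
  by rewrite avg_cst.
have EE f : ('E_Q[f] = (N^-1 * \sum_s \sum_j c j * f (xI (s, j)))%:E)%E.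
  rewrite expectation_fine -(avg (f \o xI)); congr _%:E.
  under eq_bigr => w _.
    rewrite QE; under eq_bigr do rewrite diracE -EFinM.
    rewrite sumEFin /= mulr_sumr; over.
  rewrite exchange_big; apply: eq_bigr => i _ /=.
  rewrite (bigD1 (xI i)) //= big1 => [|w wi].
    by rewrite mem_set // mulr1 addr0 mulrC.
  by rewrite memNset ?mulr0 //= => iw; rewrite iw eqxx in wi.
exists Q; split=> [s f|F].
  (* Left translation by [s] only reindexes the average over the group. *)
  rewrite !EE; congr (_ * _)%:E; rewrite [RHS](reindex_inj (@mulgI _ s)).
  by apply: eq_bigr => t _; apply: eq_bigr => j _; rewrite /= permuteM.
(* [up] and [deaths] are invariant, so every permutation contributes the same sum. *)
rewrite EE; congr _%:E; rewrite -[RHS]avg_cst; congr (_ * _).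
apply: eq_bigr => s _; apply: eq_bigr => j _.
by rewrite up_permute deaths_permute up_first_die deaths_first_die.
Qed.

(** The event with relabelled lives is the preimage under [permute s] of the original event. *)
Lemma permute_invariant_exchangeable (Q : probability (state n) R) :
  (forall s f, ('E_Q[f \o permute s] = 'E_Q[f])%E) -> exchangeable Q.
Proof.
move=> Qinv s x; rewrite -!expectation_indic // -[RHS](Qinv s).
congr ('E_Q[_])%E; apply/funext => w; rewrite /= !indicE; congr (_%:R).
by apply: congr1; apply/idP/idP; rewrite !inE /= => h i; have := h i;
  rewrite dies_permute.
Qed.

(** Transpositions give all lives the same mean, so the expected number of deaths determines the
    price of each life. *)
Lemma permute_invariant_dies (Q : probability (state n) R) (i : 'I_n) :
  (forall s f, ('E_Q[f \o permute s] = 'E_Q[f])%E) ->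
  ('E_Q[fun w => (deaths w)%:R] = n%:R%:E * 'E_Q[fun w => (dies i w)%:R])%E.
Proof.
move=> Qinv.
have Ei j : ('E_Q[fun w => (dies j w)%:R : R] = 'E_Q[fun w => (dies i w)%:R])%E.
  rewrite -(Qinv (tperm i j)); congr ('E_Q[_])%E; apply/funext => w /=.
  by rewrite dies_permute tpermR.
transitivity (\sum_(j < n) 'E_Q[fun w => (dies j w)%:R : R])%E.
  under [RHS]eq_bigr do rewrite expectation_fine.
  rewrite sumEFin exchange_big expectation_fine; congr _%:E.
  by apply: eq_bigr => w _; rewrite /deaths natr_sum mulr_suml.
under eq_bigr do rewrite Ei.
by rewrite expectation_fine sumEFin sumr_const card_ord -EFinM mulr_natl.
Qed.

End States.

(** * Linear pricing, no-arbitrage bounds and weak duality *)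

Section Pricing.
Context {R : realType} {n : nat}.
Implicit Types (mkt : market R) (f : asset n -> R) (phi psi : @portfolio R n).

Lemma valueD f phi psi : value f (phi \+ psi) = value f phi + value f psi.
Proof.
rewrite /value /=; under eq_bigr do rewrite mulrDl.
by rewrite big_split /=; ring.
Qed.

Lemma valueZ f (c : R) phi : value f (c \*o phi) = c * value f phi.
Proof.
rewrite /value /=; under eq_bigr do rewrite -mulrA.
by rewrite -mulr_sumr; ring.
Qed.

Lemma value_one_gla f : value f one_gla = f GLA.
Proof. by rewrite /value big1 /= => [|i _]; rewrite ?mul0r //; ring. Qed.

Lemma value_one_xol f : value f one_xol = f XoL.
Proof. by rewrite /value big1 /= => [|i _]; rewrite ?mul0r //; ring. Qed.

Definition one_cash : @portfolio R n := fun a => if a is Cash then 1 else 0.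

Lemma value_one_cash f : value f one_cash = f Cash.
Proof. by rewrite /value big1 /= => [|i _]; rewrite ?mul0r //; ring. Qed.

Definition valueE :=
  (valueD, valueZ, value_one_cash, value_one_gla, value_one_xol).

(* A nonnegative payout with a negative price would become an arbitrage after
   putting the proceeds in cash. *)
Lemma arbitrage_free_V0_ge0 mkt phi : @arbitrage_free R n mkt ->
  (forall w, 0 <= V1 mkt phi w) -> 0 <= V0 mkt phi.
Proof.
move=> na phi_ge0; rewrite leNgt; apply/negP => phi_lt0; apply: na.
exists (phi \+ (- V0 mkt phi) \*o one_cash).
rewrite /V0 /V1; split; rewrite ?valueE /=.
- by rewrite /V0; lra.
- move=> w; rewrite !valueE /=.
  by have := phi_ge0 w; rewrite /V0 /V1 in phi_lt0 *; lra.
- exists point; rewrite !valueE /= gt_eqF //.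
  by have := phi_ge0 point; rewrite /V0 /V1 in phi_lt0 *; lra.
Qed.

Lemma deaths_range (w : state n) : 0 <= ((deaths w)%:R : R) <= n%:R.
Proof. by rewrite ler0n ler_nat deaths_le. Qed.

(** With [e] the excess, each bound is the cost of a portfolio with nonnegative payout: the XoL; the
    XoL plus [e] cash minus a GLA; and, by convexity of the XoL payout, [n - e] GLAs minus [n]
    XoLs. *)
Lemma arbitrage_free_X0_bounds mkt : @arbitrage_free R n mkt ->
  (excess mkt <= n)%N ->
  [/\ 0 <= X0 mkt, n%:R * p mkt - (excess mkt)%:R <= X0 mkt
    & X0 mkt <= (n%:R - (excess mkt)%:R) * p mkt].
Proof.
move=> na; rewrite -(ler_nat R); set e : R := (excess mkt)%:R => en.
have e_ge0 : 0 <= e by rewrite ler0n.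
split.
- have := arbitrage_free_V0_ge0 mkt one_xol na.
  rewrite /V0 value_one_xol; apply=> w.
  by rewrite /V1 value_one_xol le_max lexx orbT.
- have := arbitrage_free_V0_ge0 mkt
    ((one_xol \+ e \*o one_cash) \+ (-1) \*o one_gla) na.
  rewrite /V0 !valueE /= => H.
  have {H} : 0 <= X0 mkt + e * 1 + -1 * (n%:R * p mkt).
    apply: H => w; rewrite /V1 !valueE /= -/e.
    by case: (lerP ((deaths w)%:R - e) 0) => we; have := deaths_range w; lra.
  by lra.
(* The third portfolio bounds [n * X0], so [n = 0] is treated apart: there the XoL pays nothing and
   can be sold short. *)
- have [n0|n_gt0] := posnP n.
    have nR : n%:R = 0 :> R by rewrite n0.
    have e0 : e = 0 by apply: le_anti; rewrite e_ge0 andbT -nR.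
    have := arbitrage_free_V0_ge0 mkt ((-1) \*o one_xol) na.
    rewrite /V0 !valueE /= => H; have {H} : 0 <= -1 * X0 mkt.
      apply: H => w; rewrite /V1 !valueE /= -/e e0.
      have := deaths_range w; rewrite nR => /le_anti <-.
      by rewrite subr0 maxxx mulr0.
    by rewrite nR e0 subrr mul0r; lra.
  have n_gt0R : 0 < n%:R :> R by rewrite ltr0n.
  have := arbitrage_free_V0_ge0 mkt
    ((n%:R - e) \*o one_gla \+ (- n%:R) \*o one_xol) na.
  rewrite /V0 !valueE /= => H.
  have {H} : 0 <= (n%:R - e) * (n%:R * p mkt) + - n%:R * X0 mkt.
    apply: H => w; rewrite /V1 !valueE /= -/e.
    have /andP[w_ge0 w_le] := deaths_range w.
    by case: (lerP ((deaths w)%:R - e) 0) => we; nra.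
  move=> H; rewrite -(ler_pM2l n_gt0R).
  by lra.
Qed.

Lemma martingale_expectation_V1 mkt (P Q : probability (state n) R) phi :
  martingale_measure mkt P Q -> ('E_Q[V1 mkt phi] = (V0 mkt phi)%:E)%E.
Proof.
case=> _ Qm; rewrite expectation_fine; congr _%:E.
set m := fun w => fine (Q [set w]%classic).
have -> : V0 mkt phi = value (fun a => \sum_w payout mkt a w * m w) phi.
  rewrite /V0; congr value; apply/funext => a.
  by have := Qm a; rewrite expectation_fine => -[].
rewrite /V1 /value /=.
under [X in _ = _ + X + _ + _]eq_bigr do rewrite mulr_sumr.
rewrite [X in _ = _ + X + _ + _]exchange_big !mulr_sumr -!big_split.
apply: eq_bigr => w _ /=; rewrite !mulrDl !mulrA mulr_suml.
by congr (_ + _ + _ + _ + _); apply: eq_bigr => i _; rewrite mulrA.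
Qed.

Lemma martingale_minimal mkt (P Q : probability (state n) R) phi C :
  martingale_measure mkt P Q -> ('E_Q[C] = (V0 mkt phi)%:E)%E ->
  superhedges mkt phi C -> minimal_superhedge mkt phi C.
Proof.
move=> Qm EC phiC; split=> // psi psiC.
rewrite -lee_fin -EC -(martingale_expectation_V1 _ _ _ psi Qm).
rewrite !expectation_fine lee_fin; apply: ler_sum => w _.
by apply: ler_wpM2r => //; rewrite fine_ge0.
Qed.

End Pricing.

(* [m0], [me], [mn] are the probabilities of 0, [e] and [N] deaths, and [v0],
   [ve], [vn] those of the same events together with a fall of the property.
   The death law is pinned down by the two prices; the mass [q] of the fall is
   then placed greedily on the largest numbers of deaths. *)
Lemma extremal_weights (R : realFieldType) (N e X p q : R) :
  0 <= e -> e <= N -> 0 <= p -> p <= 1 -> 0 <= q -> q <= 1 ->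
  0 <= X -> N * p - e <= X -> X <= (N - e) * p ->
  exists m0 me mn v0 ve vn : R,
    [/\ [/\ 0 <= v0 <= m0, 0 <= ve <= me & 0 <= vn <= mn],
        m0 + me + mn = 1, v0 + ve + vn = q,
        e * me + N * mn = N * p /\ (N - e) * mn = X
      & e * ve + N * vn =
        Num.min (Num.min (N * p) (e * q + X)) (N * q)].
Proof.
move=> e0 eN p0 p1 q0 q1 X0 Xl Xu.
have [me [mn [me0 mn0 m1 [mNp mX]]]] : exists me mn : R,
    [/\ 0 <= me, 0 <= mn, me + mn <= 1
      & e * me + N * mn = N * p /\ (N - e) * mn = X].
  (* If [e] is 0 or [N], the triangle collapses to a segment and mass [p] at [N] meets both
     prices. *)
  have [ez|ez] := eqVneq e 0.
    by exists 0, p; rewrite ez in Xl Xu *; split=> //; try split; lra.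
  have [eNz|eNz] := eqVneq e N.
    by exists 0, p; rewrite eNz in Xl Xu *; split=> //; try split; lra.
  have e_gt0 : 0 < e by rewrite lt_def ez.
  have eN_gt0 : 0 < N - e by rewrite subr_gt0 lt_def eq_sym eNz.
  pose mn := X / (N - e); pose me := (N * p - N * mn) / e.
  have mnE : (N - e) * mn = X by rewrite mulrC divfK // gt_eqF.
  have meE : e * me = N * p - N * mn by rewrite mulrC divfK // gt_eqF.
  have mn0 : 0 <= mn by rewrite divr_ge0 // ltW.
  have mnp : mn <= p by rewrite ler_pdivrMr // mulrC.
  have me0 : 0 <= me by rewrite -(pmulr_rge0 _ e_gt0) meE; nra.
  exists me, mn; split=> //; last by split=> //; lra.
  (* Multiplied by [e], the bound [me + mn <= 1] becomes [N * p - X <= e], which is [Xl]. *)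
  by rewrite -(ler_pM2l e_gt0) mulrDr meE; lra.
have mnq : N * (mn - p) <= 0.
  have h : 0 <= e * me by apply: mulr_ge0.
  by lra.
exists (1 - me - mn), me, mn.
have eme : 0 <= e * me by apply: mulr_ge0.
(* The fall takes mass at [N] first, then at [e], then at 0; the stage where [q] is used up decides
   which cost is the minimum. *)
have [qn|nq] := lerP q mn.
  have h1 : (N - e) * q <= (N - e) * mn by apply: ler_wpM2l; rewrite ?subr_ge0.
  have h2 : N * q <= N * mn by apply: ler_wpM2l => //; lra.
  exists 0, 0, q; split; try (by lra); first by split; lra.
  by rewrite min_r ?le_min; [lra | apply/andP; split; lra].
have h1 : (N - e) * mn <= (N - e) * q.
  by apply: ler_wpM2l; rewrite ?subr_ge0 // ltW.
have [qe|eq] := lerP (q - mn) me.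
  have h2 : e * (q - mn) <= e * me by apply: ler_wpM2l.
  exists 0, (q - mn), mn; split; try (by lra); first by split; lra.
  by rewrite (min_r (x := N * p)) ?min_l; lra.
have h2 : e * me <= e * (q - mn) by apply: ler_wpM2l => //; apply: ltW.
exists (q - me - mn), me, mn; split; try (by lra); first by split; lra.
by rewrite (min_l (x := N * p)) ?min_l; lra.
Qed.

(** * The three superhedges and the extremal measure *)

Section Hedging.
Context {R : realType} {n : nat} {mkt : market R} {L : R}.
Hypotheses (S0_gt0 : 0 < S0 mkt) (d_lt1 : d mkt < 1) (u_gt1 : 1 < u mkt).
Hypotheses (L_leu : L <= S0 mkt * u mkt) (L_unit : L - S0 mkt * d mkt = 1).

Lemma put_payoutE (w : state n) : put_payout mkt L w = (~~ up w)%:R.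
Proof.
rewrite /put_payout /S1; case: (up w) => /=; last by rewrite L_unit max_l.
by rewrite max_r // subr_le0.
Qed.

Lemma V1_property_put (w : state n) :
  value (payout mkt ^~ w) (property_put mkt L) = (~~ up w)%:R.
Proof.
rewrite -put_payoutE -put_replicates //.
exact: lt_trans d_lt1 u_gt1.
Qed.

Lemma gla_superhedges : superhedges mkt one_gla (nneg mkt L : state n -> R).
Proof.
move=> w; rewrite /nneg /V1 value_one_gla put_payoutE /=.
by have := deaths_range (R := R) w; case: (up w) => /=; lra.
Qed.

Lemma puts_superhedge :
  superhedges mkt (n%:R \*o property_put mkt L) (nneg mkt L : state n -> R).
Proof.
move=> w; rewrite /nneg /V1 valueZ V1_property_put put_payoutE.
by have := deaths_range (R := R) w; case: (up w) => /=; lra.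
Qed.

(** After a fall, [D <= e + max(D - e, 0)] for [D] deaths; otherwise the claim is 0 and the XoL
    payout is nonnegative. *)
Lemma puts_xol_superhedge :
  superhedges mkt ((excess mkt)%:R \*o property_put mkt L \+ one_xol)
    (nneg mkt L : state n -> R).
Proof.
move=> w; rewrite /nneg /V1 !valueE V1_property_put put_payoutE /=.
case: (lerP ((deaths w)%:R - (excess mkt)%:R : R) 0) => we.
  by case: (up w) => /=; lra.
by case: (up w) => /=; lra.
Qed.

Lemma q_itv : 0 < q mkt < 1.
Proof.
have ud_gt0 : 0 < u mkt - d mkt by rewrite subr_gt0 (lt_trans d_lt1).
have u1_gt0 : 0 < u mkt - 1 by rewrite subr_gt0.
by rewrite /q ltr_pdivrMr // divr_gt0 //= mul1r ltrD2l ltrN2.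
Qed.

Lemma extremal_measure (P : probability (state n) R) :
  0 <= p mkt -> p mkt <= 1 -> (excess mkt <= n)%N ->
  reference_measure mkt P -> @arbitrage_free R n mkt ->
  exists Q : probability (state n) R,
    exchangeable_martingale_measure mkt P Q /\
    ('E_Q[nneg mkt L] = (Num.min
       (Num.min (n%:R * p mkt) ((excess mkt)%:R * q mkt + X0 mkt))
       (n%:R * q mkt))%:E)%E.
Proof.
move=> p_ge0 p_le1 en [P_gt0 _ _] na.
have [X_ge0 X_lb X_ub] := arbitrage_free_X0_bounds _ na en.
have /andP[q_gt0 q_lt1] := q_itv.
have eN : (excess mkt)%:R <= n%:R :> R by rewrite ler_nat.
have [] := extremal_weights R n%:R (excess mkt)%:R (X0 mkt) (p mkt) (q mkt).
all: rewrite ?ler0n ?(ltW q_gt0) ?(ltW q_lt1) //.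
set e : R := (excess mkt)%:R in eN X_lb X_ub *.
move=> m0 [me [mn [v0 [ve [vn [vm m1 vq [mNp mX] vE]]]]]].
case: vm => /andP[v0_ge0 v0m] /andP[ve_ge0 vem] /andP[vn_ge0 vnm].
(* Six atoms: 0, [e] or [n] deaths, with a fall for the first three indices and without one for the
   last three. *)
pose c (j : 'I_6) := nth 0 [:: v0; ve; vn; m0 - v0; me - ve; mn - vn] j.
pose b (j : 'I_6) := (3 <= j)%N.
pose k (j : 'I_6) := nth 0 [:: 0; excess mkt; n; 0; excess mkt; n]%N j.
have [|||Q [Qinv QE]] := symmetric_mixture (n := n) _ c b k.
- by rewrite /c => -[] [|[|[|[|[|[|//]]]]]] ? /=; lra.
- by rewrite /c !big_ord_recl big_ord0 /=; lra.
- by rewrite /k => -[] [|[|[|[|[|[|//]]]]]] ? /=.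
have {}QE f F : (forall w, f w = F (up w) (deaths w)) ->
    ('E_Q[f] = (v0 * F false 0%N + ve * F false (excess mkt) + vn * F false n
      + (m0 - v0) * F true 0%N + (me - ve) * F true (excess mkt)
      + (mn - vn) * F true n)%:E)%E.
  move=> /funext ->; rewrite QE /c /b /k !big_ord_recl big_ord0 /=.
  by rewrite !addrA addr0.
have Edeaths : ('E_Q[fun w => (deaths w)%:R] = (n%:R * p mkt)%:E)%E.
  by rewrite (QE _ (fun _ k => k%:R)) //= -/e; congr _%:E; lra.
exists Q; split; last first.
  rewrite (QE _ (fun b k => k%:R * (~~ b)%:R)) => [|w]; last first.
    by rewrite /nneg put_payoutE.
  by rewrite -vE /= -/e; congr _%:E; lra.
split; last exact: permute_invariant_exchangeable.
split.
  (* [P] charges every state, so its only null set is empty. *)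
  apply/null_content_dominatesP => A _ PA.
  suff -> : A = set0 by rewrite measure0.
  rewrite -subset0 => w Aw /=.
  have := P_gt0 w; rewrite ltNge => /negP; apply; rewrite -PA.
  by apply: le_measure; rewrite ?inE // => _ ->.
case=> [||i||].
- by rewrite (QE _ (fun _ _ => 1)) //=; congr _%:E; lra.
- rewrite (QE _ (fun b _ => S0 mkt * (if b then u mkt else d mkt))) //=.
  congr _%:E; have qE : q mkt * (u mkt - d mkt) = u mkt - 1.
    by rewrite divfK // subr_eq0 gt_eqF // (lt_trans d_lt1).
  transitivity (S0 mkt * (u mkt * (m0 + me + mn)
    - (v0 + ve + vn) * (u mkt - d mkt))); first by ring.
  by rewrite m1 vq qE; ring.
(* The existence of a life [i] forces [n > 0], so [n] can be cancelled from the expected number of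
   deaths. *)
- have n_gt0 : 0 < n%:R :> R by rewrite ltr0n (leq_ltn_trans _ (ltn_ord i)).
  move: Edeaths; rewrite (permute_invariant_dies _ i Qinv) expectation_fine.
  by rewrite -EFinM => -[/mulfI->] //; rewrite gt_eqF.
- exact: Edeaths.
- rewrite (QE _ (fun _ k => Num.max (k%:R - e) 0)) //= -/e; congr _%:E.
  rewrite subrr maxxx sub0r (max_r (x := - e)) ?oppr_le0 ?ler0n //.
  by rewrite max_l ?subr_ge0 //; lra.
Qed.

End Hedging.

(** * Comparison of the three costs *)

Theorem theorem4p1 (R : realType) (n : nat) (mkt : market R) (L : R)
    (P : probability (state n) R)
    (S0_gt0 : 0 < S0 mkt) (d_gt0 : 0 < d mkt) (d_lt1 : d mkt < 1)
    (u_gt1 : 1 < u mkt) (p_gt0 : 0 < p mkt) (p_lt1 : p mkt < 1)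
    (excess_le : (excess mkt <= n)%N)
    (P_ref : reference_measure mkt P)
    (no_arb : @arbitrage_free R n mkt)
    (L_gt0 : 0 < L) (L_gtd : S0 mkt * d mkt < L) (L_leu : L <= S0 mkt * u mkt)
    (L_unit : L - S0 mkt * d mkt = 1) :
  let e : R := (excess mkt)%:R in
  let C : state n -> R := nneg mkt L in
  let put : @portfolio R n := property_put mkt L in
  [/\ exists phi : @portfolio R n,
        minimal_superhedge mkt phi C /\
        exists Q : probability (state n) R,
          exchangeable_martingale_measure mkt P Q /\
          (V0 mkt phi)%:E = ('E_Q[C])%E,
      X0 mkt / (n%:R - e) < q mkt -> e * q mkt + X0 mkt <= n%:R * p mkt ->
        minimal_superhedge mkt ((e \*o put) \+ one_xol) C /\
        V0 mkt ((e \*o put) \+ one_xol) = e * q mkt + X0 mkt,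
      n%:R * p mkt < e * q mkt + X0 mkt ->
        minimal_superhedge mkt one_gla C /\
        V0 mkt (@one_gla R n) = n%:R * p mkt
    & q mkt <= X0 mkt / (n%:R - e) ->
        minimal_superhedge mkt (n%:R \*o put) C /\
        V0 mkt (n%:R \*o put) = n%:R * q mkt].
Proof.
move=> e C put.
have [Q [QM QC]] := extremal_measure d_lt1 u_gt1 L_leu L_unit
  P (ltW p_gt0) (ltW p_lt1) excess_le P_ref no_arb.
have [X_ge0 _ X_ub] := arbitrage_free_X0_bounds _ no_arb excess_le.
have /andP[q_gt0 _] := q_itv (mkt := mkt) d_lt1 u_gt1.
rewrite -/e -/C in QC X_ub.
have en : e <= n%:R by rewrite ler_nat.
have putq : value (price mkt) put = q mkt.
  by apply: put_cost => //; apply: lt_trans d_lt1 u_gt1.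
have V0_xol : V0 mkt ((e \*o put) \+ one_xol) = e * q mkt + X0 mkt.
  by rewrite /V0 !valueE putq.
have V0_gla : V0 mkt (@one_gla R n) = n%:R * p mkt by rewrite /V0 value_one_gla.
have V0_put : V0 mkt (n%:R \*o put) = n%:R * q mkt by rewrite /V0 valueZ putq.
have minQ phi : superhedges mkt phi C -> ('E_Q[C] = (V0 mkt phi)%:E)%E ->
    minimal_superhedge mkt phi C.
  by move=> phiC ?; apply: martingale_minimal QM.1 _ phiC.
have S_xol : superhedges mkt ((e \*o put) \+ one_xol) C.
  exact: puts_xol_superhedge.
have S_gla : superhedges mkt one_gla C by exact: gla_superhedges.
have S_put : superhedges mkt (n%:R \*o put) C by exact: puts_superhedge.
split.
- suff [phi [phiC phiV]] : exists phi,
      superhedges mkt phi C /\ ('E_Q[C] = (V0 mkt phi)%:E)%E.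
    by exists phi; split; [exact: minQ | exists Q].
  rewrite QC; case: leP => _; last by exists (n%:R \*o put); rewrite V0_put.
  case: leP => _; first by exists one_gla; rewrite V0_gla.
  by exists (e \*o put \+ one_xol); rewrite V0_xol.
- move=> Xq qnp; split=> //; apply: minQ => //; rewrite QC V0_xol.
  rewrite (min_r qnp) min_l //.
  (* For [e = n] the quotient is 0 by convention and says nothing about [X0]; instead [X_ub] gives
     [X0 <= 0]. *)
  have [ne|ne] := eqVneq (n%:R - e) 0.
    by move: X_ub; rewrite ne mul0r; nra.
  move: Xq; rewrite ltr_pdivrMr; last by rewrite lt_def ne subr_ge0.
  by lra.
- move=> npq; split=> //; apply: minQ => //; rewrite QC V0_gla.
  rewrite (min_l (ltW npq)) min_l // ler_wpM2l //.
  have e_ge0 : 0 <= e by [].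
  (* If [q < p], then [e * q + X0 <= e * p + (n - e) * p = n * p], against [npq]. *)
  by rewrite leNgt; apply/negP => qp; nra.
- move=> qX; split=> //; apply: minQ => //; rewrite QC V0_put.
  (* A zero denominator would make the quotient 0, contradicting [0 < q]. *)
  have ne : 0 < n%:R - e.
    rewrite lt_def subr_ge0 en andbT; apply/eqP => ne.
    by move: qX; rewrite ne invr0 mulr0; lra.
  move: qX; rewrite ler_pdivlMr // => qX.
  (* This chains [(n - e) * q <= X0 <= (n - e) * p]. *)
  have qp : q mkt <= p mkt by rewrite -(ler_pM2l ne); lra.
  by rewrite min_r // le_min ler_wpM2l //=; lra.
Qed.
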